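(* Let $f:[0,1]\to\mathbb R$ be of class $C^1$ with $f(0)=f(1)=0$, $f>0$ in $(0,1)$ and $f'(0)=0$. Let $u_0:\mathbb R\to[0,1]$ be uniformly continuous with $u_0>0$ in $\mathbb R$, $\liminf_{x\to-\infty}u_0(x)>0$ and $\lim_{x\to+\infty}u_0(x)=0$. Let $u(t,x)$ be the solution of $\partial_t u=\partial_{xx}u+f(u)$ for $t>0$, $x\in\mathbb R$, with initial condition $u(0,\cdot)=u_0$, and let $E_\lambda(t)$ and $t_\lambda$ be as defined in the context. Let $\alpha>0$, $\delta>0$ and $\beta>1$ be such that $$\beta<1+\frac1\alpha .$$ Assume that there are $C>0$, $\overline C>0$ and $x_0>1$ such that $$\frac{\overline C}{x^\alpha}\geq u_0(x)\geq\frac{C}{x^\alpha},\quad\forall x\geq x_0.$$ Assume that there are $r>0$ and $s_0\in(0,1)$ such that $$f(s)\geq r s^\beta(1-s^\delta),\quad\forall\,0\leq s\leq s_0,$$ and that there is $\overline r>0$ such that $$\overline r s^\beta\geq f(s),\quad\forall\,0\leq s\leq1.$$ Then, for any $\lambda\in(0,1)$ and any small $\varepsilon>0$, there is a time $\overline T_{\lambda,\varepsilon}\geq t_\lambda$ such that $$E_\lambda(t)\subset(x^-(t),x^+(t)),\quad\forall t\geq\overline T_{\lambda,\varepsilon},$$ where $$x^-(t):=\left((r-\varepsilon)C^{\beta-1}(\beta-1)t\right)^{\frac{1}{\alpha(\beta-1)}},\qquad x^+(t):=\left((\overline r+\varepsilon)\overline C^{\,\beta-1}(\beta-1)t\ri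ght)^{\frac{1}{\alpha(\beta-1)}}.$$
   Context: For $\lambda\in(0,1)$ and $t\geq 0$, $E_\lambda(t):=\{x\in\mathbb R:\ u(t,x)=\lambda\}$ denotes the $\lambda$-level set of $u(t,\cdot)$. Under the stated assumptions on $f$ and $u_0$ one has $0<u(t,x)<1$ for all $t>0$, $x\in\mathbb R$; there is $\gamma>0$ such that $\lim_{t\to\infty}\inf_{x\leq\gamma t}u(t,x)=1$; and $\lim_{x\to+\infty}u(t,x)=0$ for every $t\geq0$. Such a $\gamma>0$ is fixed. Consequently, for any $\lambda\in(0,1)$ there is a time $t_\lambda>0$, which is fixed, such that $\emptyset\neq E_\lambda(t)\subset(\gamma t,+\infty)$ for all $t\geq t_\lambda$. *)

(* Defs.v *)
From Stdlib Require Import Reals.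
From Coquelicot Require Import Coquelicot.

Open Scope R_scope.

(* s^a for s >= 0 and a > 0, with 0^a = 0; note that [Rpower 0 a] is 1. *)
Definition rpow (s a : R) : R := if Rle_dec s 0 then 0 else Rpower s a.

Definition unit_interval (s : R) : Prop := 0 <= s <= 1.

(* [D_in] and [continue_in] are relative to [unit_interval], so they are
   one-sided at 0 and 1, and values of f outside [0,1] are irrelevant. *)
Definition C1_unit_interval (f df : R -> R) : Prop :=
  forall s, unit_interval s ->
    D_in f df unit_interval s /\ continue_in df unit_interval s.

Definition inf_left (g : R -> R) (a : R) : Rbar :=
  Glb_Rbar (fun y => exists x, x <= a /\ y = g x).

(* The infima increase as a decreases, so their limit as a -> -oo is their
   supremum. *)
Definition LimInf_minfty (g : R -> R) : Rbar :=
  Rbar_lub (fun l => exists a, l = inf_left g a).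

(* Classical solution of u_t = u_xx + f(u), u(0,.) = u0, with values in [0,1],
   the domain of f: continuous up to t = 0, and of class C^{1,2} for t > 0.
   The first argument of u is time. *)
Record is_solution (f u0 : R -> R) (u : R -> R -> R) : Prop := {
  sol_range : forall t x, 0 <= t -> unit_interval (u t x);
  sol_cont : forall t x, 0 <= t ->
    filterlim (fun p : R * R => u (fst p) (snd p))
      (within (fun p : R * R => 0 <= fst p) (locally (t, x)))
      (locally (u t x));
  sol_init : forall x, u 0 x = u0 x;
  sol_ex_dt : forall t x, 0 < t -> ex_derive (fun s => u s x) t;
  sol_ex_dx : forall t x, 0 < t -> ex_derive (u t) x;
  sol_ex_dxx : forall t x, 0 < t -> ex_derive_n (u t) 2 x;
  sol_cont_dt : forall t x, 0 < t ->
    continuity_2d_pt (fun s y => Derive (fun s' => u s' y) s) t x;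
  sol_cont_dx : forall t x, 0 < t ->
    continuity_2d_pt (fun s y => Derive (u s) y) t x;
  sol_cont_dxx : forall t x, 0 < t ->
    continuity_2d_pt (fun s y => Derive_n (u s) 2 y) t x;
  sol_eq : forall t x, 0 < t ->
    Derive (fun s => u s x) t = Derive_n (u t) 2 x + f (u t x)
}.

Definition level_set (u : R -> R -> R) (lambda t : R) : R -> Prop :=
  fun x => u t x = lambda.

Definition spreads_at_speed (u : R -> R -> R) (gamma : R) : Prop :=
  is_lim (fun t => real (inf_left (u t) (gamma * t))) p_infty 1.

Definition is_level_time (u : R -> R -> R) (gamma lambda t_lambda : R) : Prop :=
  0 < t_lambda /\
  forall t, t_lambda <= t ->
    (exists x, level_set u lambda t x) /\
    (forall x, level_set u lambda t x -> gamma * t < x).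

Definition front (alpha beta k c t : R) : R :=
  Rpower (k * Rpower c (beta - 1) * (beta - 1) * t) (1 / (alpha * (beta - 1))).

(* Main.v *)
Require Import Defs.
From Stdlib Require Import Reals Lra Classical ClassicalEpsilon.
From Coquelicot Require Import Coquelicot.

Open Scope R_scope.

(** Why the theorem holds.  Put p = beta - 1 and q = alpha p, so that
    0 < q < 1 is exactly the hypothesis beta < 1 + 1/alpha.  Far to the right
    the solution is small and flat, so diffusion is negligible there and each
    point follows the ODE w' = rho w^beta started from the tail c x^(-alpha).
    Its solution is w = Phi^(-1/p) with Phi = A x^q - rho p t and A = c^(-p).
    A given level of w sits where A x^q = rho p t + O(1), which is the curve
    [front alpha beta rho c].  The term w_xx is small against w^beta because it
    equals w^beta times a combination of Phi_x^2 / Phi and Phi_xx, and the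
    derivatives of x^q decay, q being less than 1.  The loss eps in the reaction
    rate pays for this error.

    To make the derivatives of x^q small everywhere, and not only at infinity,
    x^q is replaced by xi(x) = (x^2 + K^2)^(q/2) with K large
    ([regularized_power_exists]); the two differ by a bounded amount on x > 0,
    which only shifts Phi by a constant and is invisible to the front for large
    times.

    Upper bound ([upper_barrier]): with rate rbar + eps/2 the function w, capped
    at 1, lies above u at time 0 and is a supersolution where it is below 1.

    Lower bound: w itself exceeds 1 and blows up behind the front, so
    [lower_barrier] replaces Phi by a large constant plus soft_pos Phi, where
    soft_pos is a smooth, convex, 1-Lipschitz substitute for the positive part.
    This keeps the subsolution below the positive lower bound of [u0] on the left
    and, ahead of the front, amounts to shifting Phi by a constant.  It gives u >= kappa for some small
    kappa behind the front of rate r - eps/2.  A reaction that is positive on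
    [kappa, l] lifts such a plateau above any l < 1 in a fixed time
    ([growth_from_plateau]), so no point of the level set lies behind the front
    of rate r - eps once t is large.

    All three comparisons rest on one parabolic [maximum_principle] for bounded
    functions on the line. *)

(** * The parabolic maximum principle *)

Definition continuous_from_0 (z : R -> R -> R) : Prop :=
  forall t x, 0 <= t ->
    filterlim (fun p : R * R => z (fst p) (snd p))
      (within (fun p : R * R => 0 <= fst p) (locally (t, x)))
      (locally (z t x)).

Definition has_heat_derivatives (z : R -> R -> R) (t x zt zxx : R) : Prop :=
  is_derive (fun s => z s x) t zt /\
  exists zx : R -> R,
    locally x (fun y => is_derive (z t) y (zx y)) /\ is_derive zx x zxx.

(** The maximum may be attained at the final time, where only earlier times are
    available for comparison. *)
Lemma derive_nonneg_of_left_max (g : R -> R) (t l : R) :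
  0 < t -> (forall s, 0 <= s <= t -> g s <= g t) -> is_derive g t l -> 0 <= l.
Proof.
  intros ht hmax hd.
  destruct (Rle_dec 0 l) as [h|h]; [exact h|exfalso].
  apply is_derive_Reals in hd.
  destruct (hd (- l / 2) ltac:(lra)) as [d hd'].
  assert (hdp := cond_pos d).
  set (h0 := - Rmin (d / 2) t).
  assert (hh : 0 < Rmin (d / 2) t) by (apply Rmin_glb_lt; lra).
  assert (h1 := Rmin_l (d / 2) t); assert (h2 := Rmin_r (d / 2) t).
  assert (hb : Rabs h0 < d) by (unfold h0; rewrite Rabs_left; lra).
  specialize (hd' h0 ltac:(unfold h0; lra) hb).
  apply Rabs_def2 in hd'; destruct hd' as [hu _].
  assert (hq : (g (t + h0) - g t) / h0 < l / 2) by lra.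
  assert (hm := hmax (t + h0) ltac:(unfold h0; lra)).
  assert (hneg : h0 < 0) by (unfold h0; lra).
  assert (0 <= (g (t + h0) - g t) / h0); [|lra].
  replace ((g (t + h0) - g t) / h0) with ((g t - g (t + h0)) * / (- h0))
    by (field; lra).
  apply Rmult_le_pos; [lra|].
  apply Rlt_le, Rinv_0_lt_compat; lra.
Qed.

Lemma second_derive_nonpos_of_max (g dg : R -> R) (x l : R) :
  (forall y, g y <= g x) -> locally x (fun y => is_derive g y (dg y)) ->
  is_derive dg x l -> l <= 0.
Proof.
  intros hmax hloc hd.
  assert (h0 : dg x = 0).
  { assert (hx := locally_singleton _ _ hloc).
    apply is_derive_Reals in hx.
    rewrite <- (derive_pt_eq_0 _ _ _ (exist _ _ hx) hx).
    apply (deriv_maximum g (x - 1) (x + 1)); try lra.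
    intros; apply hmax. }
  destruct (Rle_dec l 0) as [h|h]; [exact h|exfalso].
  apply is_derive_Reals in hd.
  destruct (hd (l / 2) ltac:(lra)) as [d hd'].
  destruct hloc as [e he].
  assert (hdp := cond_pos d); assert (hep := cond_pos e).
  set (m := Rmin d e / 2).
  assert (hm0 : 0 < Rmin d e) by (apply Rmin_glb_lt; lra).
  assert (h1 := Rmin_l d e); assert (h2 := Rmin_r d e).
  assert (hball : forall y, x <= y <= x + m -> is_derive g y (dg y)).
  { intros y hy; apply he. apply Rabs_def1; unfold minus, plus, opp, m in *; simpl; lra. }
  destruct (MVT_cor2 g dg x (x + m)) as [c [heq hc]].
  - unfold m; lra.
  - intros y hy; apply is_derive_Reals, hball, hy.
  - assert (hcx : 0 < dg c).
    { specialize (hd' (c - x) ltac:(lra)).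
      assert (hb : Rabs (c - x) < d) by (rewrite Rabs_right; unfold m in *; lra).
      specialize (hd' hb). replace (x + (c - x)) with c in hd' by ring.
      rewrite h0 in hd'. apply Rabs_def2 in hd'.
      assert (hq : l / 2 < (dg c - 0) / (c - x)) by lra.
      apply (Rmult_lt_compat_r (c - x)) in hq; [|lra].
      replace ((dg c - 0) / (c - x) * (c - x)) with (dg c) in hq by (field; lra).
      apply Rlt_trans with (2 := hq). apply Rmult_lt_0_compat; lra. }
    assert (hmm := hmax (x + m)).
    assert (0 < dg c * (x + m - x)) by (apply Rmult_lt_0_compat; unfold m; lra).
    lra.
Qed.

(** If the supremum m were not attained, every point would have a neighbourhood
    on which z stays below m by a definite gap; compactness of the box makes the
    gap uniform, and m would not be the least upper bound. *)
Lemma attains_max_on_box (z : R -> R -> R) (T r B : R) :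
  0 <= T -> 0 <= r -> continuous_from_0 z ->
  (forall t x, 0 <= t <= T -> z t x <= B) ->
  exists t1 x1, 0 <= t1 <= T /\ - r <= x1 <= r /\
    forall t x, 0 <= t <= T -> - r <= x <= r -> z t x <= z t1 x1.
Proof.
  intros hT hr hc hB.
  set (E := fun v => exists t x, 0 <= t <= T /\ - r <= x <= r /\ v = z t x).
  destruct (completeness E) as [m [hub hlub]].
  { exists B. intros v [t [x [ht [_ ->]]]]. apply hB, ht. }
  { exists (z 0 0), 0, 0. repeat split; lra. }
  destruct (excluded_middle_informative
    (exists t x, 0 <= t <= T /\ - r <= x <= r /\ z t x = m)) as [h|h].
  { destruct h as [t1 [x1 [ht [hx he]]]]. exists t1, x1; repeat split; try lra.
    intros t x ht' hx'. rewrite he. apply hub. exists t, x; auto. }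
  exfalso.
  assert (hgap : forall t x, exists d : posreal, 0 <= t <= T -> - r <= x <= r ->
    forall s y, 0 <= s -> Rabs (s - t) < d -> Rabs (y - x) < d -> z s y <= m - d).
  { intros t x.
    destruct (excluded_middle_informative (0 <= t <= T /\ - r <= x <= r)) as [[ht hx]|n];
      [|exists (mkposreal 1 Rlt_0_1); tauto].
    assert (hlt : z t x < m).
    { assert (z t x <= m) by (apply hub; exists t, x; auto).
      destruct (Req_dec (z t x) m) as [e|e]; [|lra].
      exfalso; apply h; exists t, x; auto. }
    assert (he : 0 < (m - z t x) / 2) by lra.
    destruct (hc t x (proj1 ht) (fun w => Rabs (w - z t x) < (m - z t x) / 2)) as [d hd].
    { exists (mkposreal _ he). intros w hw; exact hw. }
    assert (hdp := cond_pos d).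
    assert (hmin : 0 < Rmin d ((m - z t x) / 2)) by (apply Rmin_glb_lt; lra).
    exists (mkposreal _ hmin); intros _ _ s y hs hst hyx; simpl in *.
    assert (h1 := Rmin_l d ((m - z t x) / 2)).
    assert (h2 := Rmin_r d ((m - z t x) / 2)).
    assert (hb : ball (t, x) d (s, y)).
    { split; [change (Rabs (s - t) < d)|change (Rabs (y - x) < d)]; lra. }
    assert (hz := hd (s, y) hb hs). simpl in hz. apply Rabs_def2 in hz. lra. }
  set (delta := fun t x => proj1_sig (constructive_indefinite_description _ (hgap t x))).
  destruct (compactness_value_2d 0 T (- r) r delta) as [d hd].
  assert (hdp := cond_pos d).
  assert (m <= m - d); [|lra].
  apply hlub. intros v [s [y [hs [hy ->]]]].
  destruct (Rle_dec (z s y) (m - d)) as [hle|hle]; [exact hle|exfalso].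
  apply (hd s y hs hy). intros [t [x [ht [hx [h1 [h2 h3]]]]]]. apply hle.
  assert (hz : z s y <= m - delta t x).
  { exact (proj2_sig (constructive_indefinite_description _ (hgap t x)) ht hx
      s y (proj1 hs) h1 h2). }
  lra.
Qed.

Lemma continuous_from_0_of_continuous (z : R -> R -> R) :
  (forall t x, continuous (fun p : R * R => z (fst p) (snd p)) (t, x)) ->
  continuous_from_0 z.
Proof.
  intros h t x _. eapply filterlim_filter_le_1; [|exact (h t x)].
  intros P [d hd]; exists d; intros p hp _; apply hd, hp.
Qed.

Lemma continuous_from_0_minus (z w : R -> R -> R) :
  continuous_from_0 z -> continuous_from_0 w ->
  continuous_from_0 (fun t x => z t x - w t x).
Proof.
  intros hz hw t x ht.
  apply (filterlim_comp_2 (H := locally (w t x)) (G := locally (z t x))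
    (fun p : R * R => z (fst p) (snd p)) (fun p : R * R => w (fst p) (snd p)) Rminus
    (hz t x ht) (hw t x ht)).
  exact (filterlim_comp_2 fst (fun p => - snd p) Rplus filterlim_fst
    (filterlim_comp _ _ _ snd Ropp _ _ _ filterlim_snd (filterlim_opp (w t x)))
    (filterlim_plus (z t x) (- w t x))).
Qed.

Lemma continuous_from_0_mult (z w : R -> R -> R) :
  continuous_from_0 z -> continuous_from_0 w ->
  continuous_from_0 (fun t x => z t x * w t x).
Proof.
  intros hz hw t x ht.
  apply (filterlim_comp_2 (H := locally (w t x)) (G := locally (z t x))
    (fun p : R * R => z (fst p) (snd p)) (fun p : R * R => w (fst p) (snd p)) Rmult
    (hz t x ht) (hw t x ht)).
  apply (filterlim_mult (K := R_AbsRing) (z t x) (w t x)).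
Qed.

Lemma continuous_time (g : R -> R) (p : R * R) :
  (forall t, ex_derive g t) -> continuous (fun p : R * R => g (fst p)) p.
Proof.
  intros h. apply continuous_comp; [destruct p; apply continuous_fst|].
  apply (ex_derive_continuous (V := R_NormedModule)), h.
Qed.

Lemma continuous_space (g : R -> R) (p : R * R) :
  (forall t, ex_derive g t) -> continuous (fun p : R * R => g (snd p)) p.
Proof.
  intros h. apply continuous_comp; [destruct p; apply continuous_snd|].
  apply (ex_derive_continuous (V := R_NormedModule)), h.
Qed.

(** Multiplying by exp(-(L+1)t) turns the growth rate L into a strictly negative
    one, and subtracting eta (x^2 + 2t) forces the maximum over the strip to be
    attained without adding any source, since x^2 + 2t solves the heat equation.
    At a positive maximum the derivative tests contradict the differential
    inequality.  That inequality is asked only where z > 0, so a barrier has to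
    be smooth and a sub- or supersolution only where the comparison would
    fail. *)
Lemma maximum_principle (z : R -> R -> R) (L T B : R) :
  0 <= L ->
  continuous_from_0 z ->
  (forall t x, 0 <= t <= T -> z t x <= B) ->
  (forall x, z 0 x <= 0) ->
  (forall t x, 0 < t <= T -> 0 < z t x ->
     exists zt zxx, has_heat_derivatives z t x zt zxx /\ zt - zxx <= L * z t x) ->
  forall t x, 0 <= t <= T -> z t x <= 0.
Proof.
  intros hL hc hB h0 hz t0 x0 ht0.
  destruct (Rle_dec (z t0 x0) 0) as [hle|hnle]; [exact hle|exfalso].
  apply Rnot_le_lt in hnle.
  set (k := L + 1).
  set (a := exp (- k * t0) * z t0 x0).
  assert (ha : 0 < a) by (apply Rmult_lt_0_compat; [apply exp_pos|exact hnle]).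
  set (S := x0 ^ 2 + 2 * t0 + 1).
  assert (hS : 0 < S) by (unfold S; assert (0 <= x0 ^ 2) by apply pow2_ge_0; lra).
  (* This eta makes the penalized value at (t0, x0) equal to eta itself. *)
  set (eta := a / S).
  assert (heta : 0 < eta) by (apply Rdiv_lt_0_compat; assumption).
  set (Z := fun t x => exp (- k * t) * z t x - eta * (x ^ 2 + 2 * t)).
  assert (hZ0 : 0 < Z t0 x0).
  { unfold Z. fold a. replace (x0 ^ 2 + 2 * t0) with (S - 1) by (unfold S; ring).
    replace (a - eta * (S - 1)) with eta by (unfold eta; field; lra). exact heta. }
  assert (hexp : forall t, 0 <= t -> 0 < exp (- k * t) <= 1).
  { intros t ht; split; [apply exp_pos|]. rewrite <- exp_0.
    assert (0 <= k * t) by (apply Rmult_le_pos; unfold k; lra).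
    destruct (Req_dec (k * t) 0) as [e|e].
    - replace (- k * t) with 0 by lra; lra.
    - left; apply exp_increasing; lra. }
  assert (hBp : 0 < B) by (specialize (hB t0 x0 ht0); lra).
  assert (hZup : forall t x, 0 <= t <= T -> Z t x <= B - eta * x ^ 2).
  { intros t x ht. unfold Z. specialize (hexp t (proj1 ht)). specialize (hB t x ht).
    assert (exp (- k * t) * z t x <= B).
    { apply Rle_trans with (exp (- k * t) * B).
      - apply Rmult_le_compat_l; lra.
      - replace B with (1 * B) at 2 by ring. apply Rmult_le_compat_r; lra. }
    assert (0 <= eta * t) by (apply Rmult_le_pos; lra).
    lra. }
  (* Beyond this radius the penalty exceeds the bound B. *)
  set (r := B / eta + 1).
  assert (hr : 1 <= r).
  { assert (0 < B / eta) by (apply Rdiv_lt_0_compat; lra). unfold r; lra. }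
  assert (hfar : forall t x, 0 <= t <= T -> ~ (- r <= x <= r) -> Z t x < 0).
  { intros t x ht hx. specialize (hZup t x ht).
    assert (r <= x ^ 2).
    { assert (r * r <= x * x).
      { destruct (Rle_dec x r).
        - assert (x < - r) by lra. nra.
        - nra. }
      nra. }
    assert (eta * r <= eta * x ^ 2) by (apply Rmult_le_compat_l; lra).
    assert (eta * r = B + eta) by (unfold r; field; lra). lra. }
  destruct (attains_max_on_box Z T r B) as [t1 [x1 [ht1 [hx1 hmax]]]].
  { lra. }
  { lra. }
  { unfold Z. apply (continuous_from_0_minus (fun t x => exp (- k * t) * z t x)
      (fun t x => eta * (x ^ 2 + 2 * t))).
    - apply (continuous_from_0_mult (fun t x => exp (- k * t)) z); [|exact hc].
      apply continuous_from_0_of_continuous; intros t x.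
      apply (continuous_time (fun t => exp (- k * t))). intros; auto_derive; exact I.
    - apply continuous_from_0_of_continuous; intros t x.
      apply (continuous_scal_r eta (fun p : R * R => snd p ^ 2 + 2 * fst p)).
      apply (continuous_plus (fun p : R * R => snd p ^ 2) (fun p : R * R => 2 * fst p)).
      + apply (continuous_space (fun x => x ^ 2)). intros; auto_derive; exact I.
      + apply (continuous_time (fun x => 2 * x)). intros; auto_derive; exact I. }
  { intros t x ht. specialize (hZup t x ht).
    assert (0 <= eta * x ^ 2) by (apply Rmult_le_pos; [lra|apply pow2_ge_0]). lra. }
  assert (hx0 : - r <= x0 <= r).
  { destruct (excluded_middle_informative (- r <= x0 <= r)) as [|n]; [assumption|].
    specialize (hfar t0 x0 ht0 n); lra. }
  assert (hZ1 : 0 < Z t1 x1) by (specialize (hmax t0 x0 ht0 hx0); lra).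
  assert (hz1 : 0 < z t1 x1).
  { unfold Z in hZ1. assert (he := hexp t1 (proj1 ht1)).
    assert (0 <= eta * (x1 ^ 2 + 2 * t1)).
    { apply Rmult_le_pos; [lra|]. assert (0 <= x1 ^ 2) by apply pow2_ge_0; lra. }
    destruct (Rlt_dec 0 (z t1 x1)); [assumption|]. nra. }
  assert (ht1p : 0 < t1).
  { destruct (Req_dec t1 0) as [->|]; [specialize (h0 x1); lra|lra]. }
  assert (hmax' : forall y, Z t1 y <= Z t1 x1).
  { intros y. destruct (excluded_middle_informative (- r <= y <= r)) as [hy|hy].
    - apply hmax; assumption.
    - specialize (hfar t1 y ht1 hy); lra. }
  destruct (hz t1 x1 ltac:(lra) hz1) as [zt [zxx [[hdt [zx [hdx hdxx]]] hle]]].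
  assert (ht : 0 <= exp (- k * t1) * (zt - k * z t1 x1) - 2 * eta).
  { apply (derive_nonneg_of_left_max (fun s => Z s x1) t1); [exact ht1p| |].
    - intros s hs; apply hmax; lra.
    - unfold Z. auto_derive.
      + repeat split; try exact I. exists zt; exact hdt.
      + rewrite (is_derive_unique (fun s : R => z s x1) t1 zt hdt). ring. }
  assert (hx : exp (- k * t1) * zxx - 2 * eta <= 0).
  { apply (second_derive_nonpos_of_max (Z t1)
      (fun y => exp (- k * t1) * zx y - 2 * eta * y) x1 _ hmax').
    - apply filter_imp with (2 := hdx). intros y hy. unfold Z. auto_derive.
      + exists (zx y); exact hy.
      + rewrite (is_derive_unique (fun y : R => z t1 y) y (zx y) hy). ring.
    - auto_derive.
      + exists zxx; exact hdxx.
      + rewrite (is_derive_unique (fun y : R => zx y) x1 zxx hdxx). ring. }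
  assert (he := hexp t1 (proj1 ht1)).
  unfold k in *. nra.
Qed.

Lemma has_heat_derivatives_minus (z w : R -> R -> R) (t x zt zxx wt wxx : R) :
  has_heat_derivatives z t x zt zxx -> has_heat_derivatives w t x wt wxx ->
  has_heat_derivatives (fun t x => z t x - w t x) t x (zt - wt) (zxx - wxx).
Proof.
  intros [hzt [zx [hzx hzxx]]] [hwt [wx [hwx hwxx]]]. split.
  - apply (is_derive_minus (V := R_NormedModule) _ _ _ _ _ hzt hwt).
  - exists (fun y => zx y - wx y). split.
    + apply filter_imp with (2 := filter_and _ _ hzx hwx); intros y [h1 h2].
      apply (is_derive_minus (V := R_NormedModule) _ _ _ _ _ h1 h2).
    + apply (is_derive_minus (V := R_NormedModule) _ _ _ _ _ hzxx hwxx).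
Qed.

Lemma has_heat_derivatives_ext_loc (z w : R -> R -> R) (t x zt zxx : R) :
  locally t (fun s => z s x = w s x) -> locally x (fun y => z t y = w t y) ->
  has_heat_derivatives z t x zt zxx -> has_heat_derivatives w t x zt zxx.
Proof.
  intros ht hx [hzt [zx [hzx hzxx]]]. split.
  - exact (is_derive_ext_loc (fun s => z s x) (fun s => w s x) t zt ht hzt).
  - exists zx; split; [|exact hzxx].
    apply locally_locally in hx.
    apply filter_imp with (2 := filter_and _ _ hx hzx); intros y [h1 h2].
    exact (is_derive_ext_loc _ _ _ _ h1 h2).
Qed.

Lemma continuous_from_0_shift (z : R -> R -> R) (t0 : R) :
  0 <= t0 -> continuous_from_0 z -> continuous_from_0 (fun s x => z (t0 + s) x).
Proof.
  intros ht0 hz t x ht P hP.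
  destruct (hz (t0 + t) x ltac:(lra) P hP) as [d hd].
  exists d. intros [s y] [hs hy] hs0.
  apply (hd (t0 + s, y)); [split|simpl in *; lra].
  - change (Rabs (t0 + s - (t0 + t)) < d). change (Rabs (s - t) < d) in hs.
    replace (t0 + s - (t0 + t)) with (s - t) by ring. exact hs.
  - exact hy.
Qed.

Lemma has_heat_derivatives_shift (z : R -> R -> R) (t0 t x zt zxx : R) :
  has_heat_derivatives z (t0 + t) x zt zxx ->
  has_heat_derivatives (fun s x => z (t0 + s) x) t x zt zxx.
Proof.
  intros [ht hx]. split; [|exact hx].
  rewrite <- (Rmult_1_l zt).
  apply (is_derive_comp (V := R_NormedModule) (fun s => z s x) (fun s => t0 + s));
    [exact ht|]. auto_derive; [exact I|ring].
Qed.

Lemma continuous_from_0_solution f u0 u :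
  is_solution f u0 u -> continuous_from_0 u.
Proof. intros h t x ht; exact (sol_cont _ _ _ h t x ht). Qed.

Lemma solution_has_heat_derivatives f u0 u t x :
  is_solution f u0 u -> 0 < t ->
  exists ut uxx, has_heat_derivatives u t x ut uxx /\ ut = uxx + f (u t x).
Proof.
  intros h ht.
  exists (Derive (fun s => u s x) t), (Derive_n (u t) 2 x). split.
  - split; [apply Derive_correct, (sol_ex_dt _ _ _ h t x ht)|].
    exists (Derive (u t)). split.
    + apply filter_forall; intros y. apply Derive_correct, (sol_ex_dx _ _ _ h t y ht).
    + exact (Derive_correct _ _ (sol_ex_dxx _ _ _ h t x ht)).
  - exact (sol_eq _ _ _ h t x ht).
Qed.

(** * Negative powers and their derivatives *)

Lemma is_derive_Rpower (a y : R) :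
  0 < y -> is_derive (fun y => Rpower y a) y (a * Rpower y (a - 1)).
Proof.
  intros hy. apply is_derive_Reals, derivable_pt_lim_power, hy.
Qed.

Lemma Rpower_neg_antitone (a b k : R) :
  0 <= k -> 0 < a <= b -> Rpower b (- k) <= Rpower a (- k).
Proof.
  intros hk hab. rewrite !Rpower_Ropp.
  apply Rinv_le_contravar; [apply exp_pos|apply Rle_Rpower_l; assumption].
Qed.

Lemma Rpower_neg_antitone_strict (a b k : R) :
  0 < k -> 0 < a < b -> Rpower b (- k) < Rpower a (- k).
Proof.
  intros hk hab. unfold Rpower. apply exp_increasing.
  assert (ln a < ln b) by (apply ln_increasing; lra). nra.
Qed.

Lemma Rpower_neg_root (y k : R) :
  0 < y -> k <> 0 -> Rpower (Rpower y (- / k)) (- k) = y.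
Proof.
  intros hy hk. rewrite Rpower_mult.
  replace (- / k * - k) with 1 by (field; assumption). apply Rpower_1, hy.
Qed.

(** For k = 1/p the common factor Phi^(-k-1) is w^beta, with w = Phi^(-k): the
    diffusion of w is measured in units of the reaction, the convex part coming
    from the slope of Phi and the rest from its curvature. *)
Lemma has_heat_derivatives_negative_power (k : R) (Phi : R -> R -> R) (t x Pt : R)
    (Px : R -> R) (Pxx : R) :
  0 < Phi t x ->
  is_derive (fun s => Phi s x) t Pt ->
  locally x (fun y => is_derive (Phi t) y (Px y)) ->
  is_derive Px x Pxx ->
  has_heat_derivatives (fun t x => Rpower (Phi t x) (- k)) t x
    (- k * Pt * Rpower (Phi t x) (- k - 1))
    (Rpower (Phi t x) (- k - 1) * (k * (k + 1) * (Px x) ^ 2 / Phi t x - k * Pxx)).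
Proof.
  intros hpos ht hx hxx. split.
  - replace (- k * Pt * Rpower (Phi t x) (- k - 1))
      with (Pt * (- k * Rpower (Phi t x) (- k - 1))) by ring.
    apply (is_derive_comp (V := R_NormedModule) (fun y => Rpower y (- k))
      (fun s => Phi s x)); [|exact ht].
    apply is_derive_Rpower, hpos.
  - exists (fun y => Px y * (- k * Rpower (Phi t y) (- k - 1))). split.
    + assert (hloc : locally x (fun y => 0 < Phi t y)).
      { assert (hc : continuous (Phi t) x).
        { apply (ex_derive_continuous (V := R_NormedModule)).
          exists (Px x). exact (locally_singleton _ _ hx). }
        exact (hc _ (open_gt 0 (Phi t x) hpos)). }
      apply filter_imp with (2 := filter_and _ _ hloc hx). intros y [h1 h2].
      apply (is_derive_comp (V := R_NormedModule) (fun y => Rpower y (- k))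
        (Phi t)); [|exact h2].
      apply is_derive_Rpower, h1.
    + assert (hP := locally_singleton _ _ hx).
      assert (hcomp : is_derive (fun y => - k * Rpower (Phi t y) (- k - 1)) x
        (- k * (Px x * ((- k - 1) * Rpower (Phi t x) (- k - 1 - 1))))).
      { apply is_derive_scal.
        apply (is_derive_comp (V := R_NormedModule) (fun y => Rpower y (- k - 1))
          (Phi t)); [|exact hP]. apply is_derive_Rpower, hpos. }
      assert (hs : Rpower (Phi t x) (- k - 1 - 1) = Rpower (Phi t x) (- k - 1) / Phi t x).
      { unfold Rminus at 1. rewrite Rpower_plus, (Rpower_Ropp _ 1), Rpower_1 by exact hpos.
        reflexivity. }
      rewrite hs in hcomp.
      assert (hm := is_derive_mult _ _ _ _ _ hxx hcomp Rmult_comm).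
      replace (Rpower (Phi t x) (- k - 1) * (k * (k + 1) * Px x ^ 2 / Phi t x - k * Pxx))
        with (Pxx * (- k * Rpower (Phi t x) (- k - 1)) +
              Px x * (- k * (Px x * ((- k - 1) * (Rpower (Phi t x) (- k - 1) / Phi t x)))))
        by (field; lra).
      exact hm.
Qed.

Lemma rpow_pos_eq (s a : R) : 0 < s -> rpow s a = Rpower s a.
Proof. intros h; unfold rpow; destruct (Rle_dec s 0); [lra|reflexivity]. Qed.

Lemma Rpower_le_1 (s a : R) : 0 < s <= 1 -> 0 <= a -> Rpower s a <= 1.
Proof.
  intros hs ha. apply Rle_trans with (Rpower 1 a).
  - apply Rle_Rpower_l; lra.
  - right. unfold Rpower. rewrite ln_1, Rmult_0_r. apply exp_0.
Qed.

(** The derivative of s^beta is at most beta on [0, 1] since beta > 1. *)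
Lemma rpow_lipschitz (beta a b : R) :
  1 < beta -> 0 <= a < b -> b <= 1 ->
  rpow b beta - rpow a beta <= beta * (b - a).
Proof.
  intros hbeta hab hb1. rewrite (rpow_pos_eq b) by lra.
  destruct (Req_dec a 0) as [->|na].
  - unfold rpow; destruct (Rle_dec 0 0) as [_|n]; [|lra].
    replace beta with (1 + (beta - 1)) at 1 by ring.
    rewrite Rpower_plus, Rpower_1 by lra.
    assert (Rpower b (beta - 1) <= 1) by (apply Rpower_le_1; lra). nra.
  - rewrite rpow_pos_eq by lra.
    destruct (MVT_cor2 (fun y => Rpower y beta) (fun y => beta * Rpower y (beta - 1)) a b)
      as [c [heq hc]].
    + lra.
    + intros c hc. apply derivable_pt_lim_power; lra.
    + rewrite heq. apply Rmult_le_compat_r; [lra|].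
      assert (Rpower c (beta - 1) <= 1) by (apply Rpower_le_1; lra). nra.
Qed.

(** * A slowly varying substitute for x^q *)

(** A stand-in for x^q whose first two derivatives are at most [mu] on the whole
    line, at the price of a bounded error on the half-line x > 0. *)
Record regularized_power (q mu : R) (xi dxi ddxi : R -> R) (B : R) : Prop := {
  rp_derive : forall x, is_derive xi x (dxi x);
  rp_derive2 : forall x, is_derive dxi x (ddxi x);
  rp_slope : forall x, Rabs (dxi x) <= mu;
  rp_bend : forall x, Rabs (ddxi x) <= mu;
  rp_lower : forall x, 0 < x -> Rpower x q <= xi x;
  rp_upper : forall x, 0 < x -> xi x <= Rpower x q + B
}.

(** Write s^q = s s^(q-1); the second factor decreases. *)
Lemma Rpower_subadditive (q x y : R) :
  0 < q < 1 -> 0 < x -> 0 < y -> Rpower (x + y) q <= Rpower x q + Rpower y q.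
Proof.
  intros hq hx hy.
  assert (hsplit : forall s, 0 < s -> Rpower s q = s * Rpower s (- (1 - q))).
  { intros s hs. rewrite <- (Rpower_1 s) at 2 by exact hs.
    rewrite <- Rpower_plus. f_equal; ring. }
  rewrite (hsplit (x + y)), (hsplit x), (hsplit y) by lra.
  rewrite Rmult_plus_distr_r.
  apply Rplus_le_compat; (apply Rmult_le_compat_l; [lra|]);
    apply Rpower_neg_antitone; lra.
Qed.

(** The function is xi = S^(q/2) with S = x^2 + K^2.  Its slope and its curvature
    are at most q K^(q-1) for K >= 1, which tends to 0 as K grows because q < 1;
    the error K^q comes from x^2 + K^2 <= (x + K)^2 and subadditivity. *)
Lemma regularized_power_exists (q mu : R) :
  0 < q < 1 -> 0 < mu ->
  exists xi dxi ddxi B, regularized_power q mu xi dxi ddxi B.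
Proof.
  intros hq hmu.
  set (nu := Rmin mu 1).
  assert (hnu : 0 < nu) by (apply Rmin_glb_lt; lra).
  assert (hnu1 := Rmin_r mu 1 : nu <= 1). assert (hnumu := Rmin_l mu 1 : nu <= mu).
  set (K := Rpower nu (- / (1 - q))).
  assert (hK : 0 < K) by apply exp_pos.
  assert (hKnu : Rpower K (- (1 - q)) = nu) by (apply Rpower_neg_root; lra).
  assert (hK1 : 1 <= K).
  { apply Rle_trans with (Rpower 1 (- / (1 - q))).
    - unfold Rpower. rewrite ln_1, Rmult_0_r, exp_0; lra.
    - apply Rpower_neg_antitone; [|lra]. left; apply Rinv_0_lt_compat; lra. }
  set (S := fun x => x ^ 2 + K ^ 2).
  assert (hx2 : forall x : R, 0 <= x ^ 2) by (intros; apply pow2_ge_0).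
  assert (hS : forall x, 0 < S x).
  { intros x; unfold S. specialize (hx2 x). assert (0 < K ^ 2) by (apply pow_lt; lra). lra. }
  assert (hdS : forall a x, is_derive (fun x => Rpower (S x) a) x
                              (2 * x * (a * Rpower (S x) (a - 1)))).
  { intros a x. apply (is_derive_comp (V := R_NormedModule) (fun y => Rpower y a) S).
    - apply is_derive_Rpower, hS.
    - unfold S; auto_derive; [exact I|ring]. }
  assert (hpow : forall y, 0 < y -> Rpower (y ^ 2) (q / 2) = Rpower y q).
  { intros y hy. rewrite <- (Rpower_pow 2 y hy), Rpower_mult. f_equal. simpl. field. }
  (* The slope is q x P and the curvature is of size q P. *)
  set (P := fun x => Rpower (S x) (q / 2 - 1)).
  assert (hPpos : forall x, 0 < P x) by (intros; apply exp_pos).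
  assert (hroot : forall x, P x * sqrt (S x) <= nu).
  { intros x. rewrite <- Rpower_sqrt by apply hS. unfold P. rewrite <- Rpower_plus.
    replace (q / 2 - 1 + / 2) with (- ((1 - q) / 2)) by field.
    rewrite <- hKnu.
    replace (Rpower K (- (1 - q))) with (Rpower (K ^ 2) (- ((1 - q) / 2))).
    - apply Rpower_neg_antitone; [lra|]. unfold S. specialize (hx2 x).
      assert (0 < K ^ 2) by (apply pow_lt; lra). lra.
    - rewrite <- (Rpower_pow 2 K hK), Rpower_mult. f_equal. simpl. field. }
  assert (hsqrt : forall x, Rabs x <= sqrt (S x) /\ 1 <= sqrt (S x)).
  { intros x; split.
    - rewrite <- sqrt_Rsqr_abs. apply sqrt_le_1_alt. unfold S, Rsqr.
      specialize (hx2 K). lra.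
    - rewrite <- sqrt_1. apply sqrt_le_1_alt. unfold S. specialize (hx2 x). nra. }
  assert (hPnu : forall x, P x <= nu).
  { intros x. specialize (hroot x); specialize (hsqrt x); specialize (hPpos x). nra. }
  exists (fun x => Rpower (S x) (q / 2)), (fun x => q * x * P x),
    (fun x => q * P x * (1 - (2 - q) * (x ^ 2 / S x))), (Rpower K q).
  split.
  - intros x. unfold P.
    replace (q * x * Rpower (S x) (q / 2 - 1))
      with (2 * x * (q / 2 * Rpower (S x) (q / 2 - 1))) by field.
    apply hdS.
  - intros x. assert (hd := hdS (q / 2 - 1) x). fold P in hd.
    assert (hl : is_derive (fun y => q * y) x q) by (auto_derive; [exact I|ring]).
    assert (hm := is_derive_mult _ _ _ _ _ hl hd Rmult_comm).
    assert (hs : Rpower (S x) (q / 2 - 1 - 1) = P x / S x).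
    { unfold Rminus at 1. rewrite Rpower_plus, (Rpower_Ropp _ 1), Rpower_1 by apply hS.
      reflexivity. }
    rewrite hs in hm. assert (hSx := hS x).
    replace (q * P x * (1 - (2 - q) * (x ^ 2 / S x)))
      with (q * P x + q * x * (2 * x * ((q / 2 - 1) * (P x / S x)))) by (field; lra).
    exact hm.
  - intros x. specialize (hroot x); specialize (hsqrt x); specialize (hPpos x).
    rewrite Rabs_mult, Rabs_mult, (Rabs_right q), (Rabs_right (P x)) by lra.
    assert (0 <= Rabs x) by apply Rabs_pos.
    assert (Rabs x * P x <= nu) by nra. nra.
  - intros x. specialize (hPnu x); specialize (hPpos x); specialize (hS x).
    assert (h1 : 0 <= x ^ 2 / S x <= 1).
    { split.
      - apply Rmult_le_pos; [apply hx2|]. left; apply Rinv_0_lt_compat, hS.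
      - apply Rmult_le_reg_r with (S x); [exact hS|].
        unfold Rdiv; rewrite Rmult_assoc, Rinv_l by lra.
        unfold S. specialize (hx2 K). lra. }
    set (y := x ^ 2 / S x) in *.
    assert (hb : -1 <= 1 - (2 - q) * y <= 1) by nra.
    assert (hqP : 0 < q * P x <= mu) by nra.
    apply Rabs_le. nra.
  - intros x hx. rewrite <- hpow by exact hx. apply Rle_Rpower_l; [lra|].
    split; [apply pow_lt, hx|]. unfold S. specialize (hx2 K). lra.
  - intros x hx.
    apply Rle_trans with (Rpower (x + K) q); [|apply Rpower_subadditive; assumption].
    rewrite <- hpow by lra. apply Rle_Rpower_l; [lra|].
    split; [apply hS|]. unfold S. nra.
Qed.

Lemma regularized_power_lipschitz q mu xi dxi ddxi B :
  regularized_power q mu xi dxi ddxi B ->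
  forall x y, xi y <= xi x + mu * Rabs (y - x).
Proof.
  intros h x y.
  destruct (MVT_gen xi x y dxi) as [c [_ heq]].
  - intros; apply (rp_derive _ _ _ _ _ _ h).
  - intros z _. apply continuity_pt_filterlim.
    apply (ex_derive_continuous (V := R_NormedModule)). eexists. apply (rp_derive _ _ _ _ _ _ h).
  - assert (hs := rp_slope _ _ _ _ _ _ h c).
    assert (xi y - xi x <= Rabs (dxi c) * Rabs (y - x)).
    { rewrite heq, <- Rabs_mult. apply Rle_abs. }
    assert (0 <= Rabs (y - x)) by apply Rabs_pos. nra.
Qed.

Lemma ex_derive_regularized_power q mu xi dxi ddxi B x :
  regularized_power q mu xi dxi ddxi B -> ex_derive xi x.
Proof. intros h; exists (dxi x); apply (rp_derive _ _ _ _ _ _ h). Qed.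

(** * The upper barrier *)

Lemma continuous_Rmax (a x : R) : continuous (fun y => Rmax y a) x.
Proof.
  apply continuous_ext with (fun y => (y + a + Rabs (y - a)) * / 2).
  - intros y. unfold Rmax, Rabs. destruct (Rle_dec y a), (Rcase_abs (y - a)); lra.
  - apply (continuous_scal_l (K := R_AbsRing) (V := R_NormedModule)
      (fun y => y + a + Rabs (y - a)) (/ 2)).
    apply (continuous_plus (V := R_NormedModule) (fun y => y + a) (fun y => Rabs (y - a))).
    + apply (continuous_plus (V := R_NormedModule) (fun y => y) (fun _ => a));
        [apply continuous_id|apply continuous_const].
    + apply continuous_Rabs_comp.
      apply (continuous_minus (V := R_NormedModule) (fun y => y) (fun _ => a));
        [apply continuous_id|apply continuous_const].
Qed.

(** Comparison with the supersolution Phi^(-1/p), Phi = A xi - rho p t - B, capped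
    at 1.  The spare rate rho - rbar absorbs its diffusion.  The constant B is
    chosen so that Phi <= 1 on x <= x0, where the tail bound is not available. *)
Lemma upper_barrier f u0 u (p q A rbar rho x0 : R) :
  is_solution f u0 u -> 0 < p -> 0 < q < 1 -> 0 < A -> 0 < rbar < rho -> 0 < x0 ->
  (forall s, 0 <= s <= 1 -> f s <= rbar * rpow s (1 + p)) ->
  (forall x, x0 <= x -> u0 x <= Rpower (A * Rpower x q) (- / p)) ->
  exists B, forall t x, 0 <= t -> 0 < x -> 1 <= A * Rpower x q - rho * p * t - B ->
    u t x <= Rpower (A * Rpower x q - rho * p * t - B) (- / p).
Proof.
  intros hu hp hq hA hrho hx0 hf hu0.
  set (k := / p).
  assert (hk : 0 < k) by (apply Rinv_0_lt_compat, hp).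
  assert (hkp : k * p = 1) by (unfold k; field; lra).
  set (D := k * (k + 1) * A ^ 2 + k * A).
  assert (hA2 : 0 < A ^ 2) by (apply pow_lt, hA).
  assert (hkk : 0 < k * (k + 1)) by nra.
  assert (hD : 0 < D) by (unfold D; nra).
  set (mu := Rmin 1 ((rho - rbar) / D)).
  assert (hmu : 0 < mu).
  { apply Rmin_glb_lt; [lra|]. apply Rdiv_lt_0_compat; lra. }
  assert (hmu1 : mu <= 1) by apply Rmin_l.
  assert (hmuD : D * mu <= rho - rbar).
  { apply Rle_trans with (D * ((rho - rbar) / D)).
    - apply Rmult_le_compat_l; [lra|apply Rmin_r].
    - right; field; lra. }
  destruct (regularized_power_exists q mu hq hmu) as [xi [dxi [ddxi [B0 hxi]]]].
  assert (hlip := regularized_power_lipschitz _ _ _ _ _ _ hxi).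
  set (B := A * (B0 + Rpower x0 q + mu * x0)).
  exists B.
  set (Phi := fun t x => A * xi x - rho * p * t - B).
  (* xi also grows towards -oo; freezing it on x <= 0 keeps the barrier equal to 1
     there. *)
  set (v := fun t x => Rpower (Rmax (Phi t (Rmax x 0)) 1) (- k)).
  assert (hv0 : forall t x, 0 < v t x) by (intros; apply exp_pos).
  assert (hone : Rpower 1 (- k) = 1)
    by (unfold Rpower; rewrite ln_1, Rmult_0_r; apply exp_0).
  assert (hleft : forall t x, 0 <= t -> 1 < Phi t (Rmax x 0) -> x0 < x).
  { intros t x ht hP. apply Rnot_le_lt; intros hx. unfold Phi in hP.
    assert (hm : 0 <= Rmax x 0 <= x0) by (split; [apply Rmax_r|apply Rmax_lub; lra]).
    specialize (hlip x0 (Rmax x 0)). rewrite Rabs_left1 in hlip by lra.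
    assert (hup := rp_upper _ _ _ _ _ _ hxi x0 hx0).
    assert (0 <= rho * p * t) by (apply Rmult_le_pos; [nra|exact ht]).
    assert (xi (Rmax x 0) <= B0 + Rpower x0 q + mu * x0) by nra.
    assert (A * xi (Rmax x 0) <= B) by (apply Rmult_le_compat_l; lra). lra. }
  assert (hcmp : forall t x, 0 <= t -> u t x <= v t x).
  { intros t1 x1 ht1. apply Rminus_le.
    apply (maximum_principle (fun t x => u t x - v t x) (rbar * (1 + p)) t1 1).
    - nra.
    - apply (continuous_from_0_minus u v).
      + exact (continuous_from_0_solution _ _ _ hu).
      + apply continuous_from_0_of_continuous. intros t x. unfold v.
        apply (continuous_comp (fun s : R * R => Phi (fst s) (Rmax (snd s) 0))
                 (fun y => Rpower (Rmax y 1) (- k))).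
        * unfold Phi. apply (continuous_minus (V := R_NormedModule)
            (fun s : R * R => A * xi (Rmax (snd s) 0) - rho * p * fst s) (fun _ => B));
            [|apply continuous_const].
          apply (continuous_minus (V := R_NormedModule)
            (fun s : R * R => A * xi (Rmax (snd s) 0)) (fun s => rho * p * fst s)).
          -- apply (continuous_comp (fun s : R * R => Rmax (snd s) 0) (fun y => A * xi y)).
             ++ apply (continuous_comp (fun s : R * R => snd s) (fun y => Rmax y 0));
                  [apply continuous_snd|apply continuous_Rmax].
             ++ apply (ex_derive_continuous (V := R_NormedModule)).
                apply (ex_derive_scal xi A), (ex_derive_regularized_power _ _ _ _ _ _ _ hxi).
          -- apply (continuous_time (fun s => rho * p * s)). intros; auto_derive; exact I.
        * apply (continuous_comp (fun y => Rmax y 1) (fun y => Rpower y (- k)));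
            [apply continuous_Rmax|].
          apply (ex_derive_continuous (V := R_NormedModule)). eexists.
          apply is_derive_Rpower. simpl. apply Rlt_le_trans with 1; [lra|apply Rmax_r].
    - intros t x ht. assert (hr := sol_range _ _ _ hu t x (proj1 ht)).
      unfold unit_interval in hr. specialize (hv0 t x). lra.
    - intros x. rewrite (sol_init _ _ _ hu).
      assert (hr := sol_range _ _ _ hu 0 x (Rle_refl 0)). rewrite (sol_init _ _ _ hu) in hr.
      unfold unit_interval in hr.
      unfold v. destruct (Rle_dec (Phi 0 (Rmax x 0)) 1) as [hP|hP].
      + rewrite Rmax_right, hone by exact hP. lra.
      + apply Rnot_le_lt in hP. rewrite Rmax_left by lra.
        assert (hx := hleft 0 x (Rle_refl 0) hP).
        rewrite Rmax_left in hP |- * by lra.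
        assert (hup := rp_upper _ _ _ _ _ _ hxi x ltac:(lra)).
        assert (hPx : Phi 0 x <= A * Rpower x q).
        { unfold Phi, B. assert (0 < Rpower x0 q) by apply exp_pos.
          assert (0 < mu * x0) by (apply Rmult_lt_0_compat; lra). nra. }
        assert (Rpower (A * Rpower x q) (- k) <= Rpower (Phi 0 x) (- k))
          by (apply Rpower_neg_antitone; lra).
        specialize (hu0 x ltac:(lra)). fold k in hu0. lra.
    - intros t x ht hz.
      assert (hr := sol_range _ _ _ hu t x ltac:(lra)). unfold unit_interval in hr.
      assert (hP : 1 < Phi t (Rmax x 0)).
      { apply Rnot_le_lt; intros hP. unfold v in hz.
        rewrite Rmax_right, hone in hz by exact hP. lra. }
      assert (hx := hleft t x ltac:(lra) hP).
      rewrite Rmax_left in hP by lra.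
      assert (hveq : v t x = Rpower (Phi t x) (- k)).
      { unfold v. rewrite (Rmax_left x 0), Rmax_left by lra. reflexivity. }
      assert (hPx : forall y, is_derive (Phi t) y (A * dxi y)).
      { intros y. unfold Phi. assert (hd := rp_derive _ _ _ _ _ _ hxi y).
        auto_derive; [eexists; exact hd|].
        rewrite (is_derive_unique (fun y : R => xi y) y _ hd). ring. }
      assert (hPt : forall s y, is_derive (fun s => Phi s y) s (- (rho * p))).
      { intros s y. unfold Phi. auto_derive; [exact I|ring]. }
      assert (hPxx : is_derive (fun y => A * dxi y) x (A * ddxi x)).
      { apply is_derive_scal, (rp_derive2 _ _ _ _ _ _ hxi). }
      assert (hdv := has_heat_derivatives_negative_power k Phi t x _ _ _ ltac:(lra)
        (hPt t x) (filter_forall _ hPx) hPxx).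
      (* Where the comparison would fail both caps are inactive nearby. *)
      apply (has_heat_derivatives_ext_loc _ v) in hdv.
      2: { assert (hc : continuous (fun s => Phi s x) t).
           { apply (ex_derive_continuous (V := R_NormedModule)). eexists; apply hPt. }
           apply (filter_imp (fun s => 1 < Phi s x)); [|exact (hc _ (open_gt 1 (Phi t x) hP))].
           intros s hs. unfold v. rewrite (Rmax_left x 0), Rmax_left by lra. reflexivity. }
      2: { assert (hc : continuous (Phi t) x).
           { apply (ex_derive_continuous (V := R_NormedModule)). eexists; apply hPx. }
           apply (filter_imp (fun y => 1 < Phi t y /\ 0 < y)).
           2: { apply filter_and; [exact (hc _ (open_gt 1 (Phi t x) hP))|].
                apply open_gt; lra. }
           intros y [hs hy]. unfold v. rewrite (Rmax_left y 0), Rmax_left by lra. reflexivity. }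
      destruct (solution_has_heat_derivatives f u0 u t x hu ltac:(lra)) as [ut [uxx [hdu he]]].
      eexists; eexists; split; [exact (has_heat_derivatives_minus _ _ _ _ _ _ _ _ hdu hdv)|].
      assert (hV : Rpower (Phi t x) (- k - 1) = rpow (v t x) (1 + p)).
      { rewrite rpow_pos_eq, hveq, Rpower_mult by apply hv0. f_equal. lra. }
      rewrite hV.
      assert (hVp : 0 < rpow (v t x) (1 + p)) by (rewrite <- hV; apply exp_pos).
      set (V := rpow (v t x) (1 + p)) in *.
      assert (hLip : rpow (u t x) (1 + p) - V <= (1 + p) * (u t x - v t x)).
      { apply rpow_lipschitz; [lra| |lra]. specialize (hv0 t x). lra. }
      assert (hfu := hf (u t x) hr).
      assert (hs := rp_slope _ _ _ _ _ _ hxi x). assert (hb := rp_bend _ _ _ _ _ _ hxi x).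
      assert (hgain : k * (k + 1) * (A * dxi x) ^ 2 / Phi t x - k * (A * ddxi x)
                      <= rho - rbar).
      { apply Rle_trans with (D * mu); [|exact hmuD].
        assert (h1 : (dxi x) ^ 2 <= mu).
        { rewrite <- pow2_abs. assert (0 <= Rabs (dxi x)) by apply Rabs_pos. nra. }
        assert (h0 : 0 <= (dxi x) ^ 2) by apply pow2_ge_0.
        assert (h2 : k * (k + 1) * (A * dxi x) ^ 2 / Phi t x <= k * (k + 1) * A ^ 2 * mu).
        { apply Rle_trans with (k * (k + 1) * A ^ 2 * (dxi x) ^ 2).
          - assert (hn : 0 <= k * (k + 1) * A ^ 2 * (dxi x) ^ 2) by
              (apply Rmult_le_pos; [nra|exact h0]).
            assert (hi : / Phi t x <= 1) by (rewrite <- Rinv_1; apply Rinv_le_contravar; lra).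
            replace (k * (k + 1) * (A * dxi x) ^ 2 / Phi t x)
              with (k * (k + 1) * A ^ 2 * (dxi x) ^ 2 * / Phi t x) by (field; lra).
            nra.
          - apply Rmult_le_compat_l; nra. }
        assert (h3 : - ddxi x <= mu).
        { apply Rle_trans with (2 := hb). rewrite <- Rabs_Ropp. apply Rle_abs. }
        assert (h4 : k * A * (- ddxi x) <= k * A * mu) by (apply Rmult_le_compat_l; nra).
        unfold D. nra. }
      assert (hfin : - k * - (rho * p) = rho) by nra.
      rewrite he, hfin.
      assert (hmain : rbar * V <= V * (rho - (k * (k + 1) * (A * dxi x) ^ 2 / Phi t x
                                              - k * (A * ddxi x)))) by nra.
      nra.
    - lra. }
  intros t x ht hx h1.
  apply Rle_trans with (1 := hcmp t x ht). unfold v.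
  assert (hlo := rp_lower _ _ _ _ _ _ hxi x hx).
  apply Rpower_neg_antitone; [lra|]. split; [lra|].
  rewrite (Rmax_left x 0) by lra.
  apply Rle_trans with (Phi t x); [unfold Phi; nra|apply Rmax_l].
Qed.

(** * The lower barrier *)

(** A smooth, convex substitute for max(y, 0) that stays above it, with slope in
    [0, 1] and bounded curvature. *)
Definition soft_pos (y : R) : R := (y + sqrt (y ^ 2 + 1)) / 2.
Definition soft_pos' (y : R) : R := (1 + y / sqrt (y ^ 2 + 1)) / 2.
Definition soft_pos'' (y : R) : R := / (2 * sqrt (y ^ 2 + 1) ^ 3).

Lemma sqrt_gt_Rabs (y : R) : 1 <= sqrt (y ^ 2 + 1) /\ Rabs y < sqrt (y ^ 2 + 1).
Proof.
  assert (0 <= y ^ 2) by apply pow2_ge_0. split.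
  - rewrite <- sqrt_1 at 1. apply sqrt_le_1_alt. lra.
  - rewrite <- sqrt_Rsqr_abs. apply sqrt_lt_1_alt. unfold Rsqr. split; nra.
Qed.

Lemma soft_pos_bounds (y : R) : 0 < soft_pos y /\ y <= soft_pos y.
Proof.
  destruct (sqrt_gt_Rabs y) as [_ h]. apply Rabs_def2 in h. unfold soft_pos. lra.
Qed.

Lemma soft_pos_nonpos (y : R) : y <= 0 -> soft_pos y <= 1 / 2.
Proof.
  intros hy. unfold soft_pos. assert (sqrt (y ^ 2 + 1) <= 1 - y); [|lra].
  rewrite <- (sqrt_pow2 (1 - y)) by lra. apply sqrt_le_1_alt. nra.
Qed.

Lemma is_derive_soft_pos (y : R) : is_derive soft_pos y (soft_pos' y).
Proof.
  unfold soft_pos, soft_pos'. assert (0 <= y ^ 2) by apply pow2_ge_0.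
  destruct (sqrt_gt_Rabs y) as [h _].
  auto_derive; [simpl in *; lra|]. simpl in *. field. lra.
Qed.

Lemma is_derive_soft_pos' (y : R) : is_derive soft_pos' y (soft_pos'' y).
Proof.
  unfold soft_pos', soft_pos''. assert (h2 : 0 <= y ^ 2) by apply pow2_ge_0.
  destruct (sqrt_gt_Rabs y) as [h _].
  assert (hs := sqrt_sqrt (y ^ 2 + 1) ltac:(lra)).
  auto_derive.
  - simpl in *; repeat split; lra.
  - replace (y * (y * 1) + 1) with (y ^ 2 + 1) by ring.
    set (s := sqrt (y ^ 2 + 1)) in *.
    transitivity ((s * s - y ^ 2) / (2 * s ^ 3)); [field; lra|].
    rewrite hs. field; lra.
Qed.

Lemma soft_pos'_bounds (y : R) : 0 <= soft_pos' y <= 1.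
Proof.
  destruct (sqrt_gt_Rabs y) as [h1 h]. apply Rabs_def2 in h. unfold soft_pos'.
  assert (-1 <= y / sqrt (y ^ 2 + 1) <= 1); [|lra].
  set (s := sqrt (y ^ 2 + 1)) in *.
  assert (hs : 0 < / s) by (apply Rinv_0_lt_compat; lra).
  assert (s * / s = 1) by (apply Rinv_r; lra). unfold Rdiv. split; nra.
Qed.

Lemma soft_pos''_bounds (y : R) : 0 <= soft_pos'' y <= 1.
Proof.
  destruct (sqrt_gt_Rabs y) as [h1 _]. unfold soft_pos''.
  assert (0 <= y ^ 2) by apply pow2_ge_0.
  set (s := sqrt (y ^ 2 + 1)) in *.
  assert (h : 1 <= 2 * s ^ 3) by (simpl; nra).
  split; [left; apply Rinv_0_lt_compat; lra|].
  rewrite <- Rinv_1. apply Rinv_le_contravar; lra.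
Qed.

(** Comparison with the subsolution Phi^(-1/p), Phi = K + soft_pos(A xi - rho p t).
    The term in Phi_x^2 / Phi has the favourable sign, and the spare rate
    rho' - rho absorbs the curvature of Phi.  Since Phi > K, a large K keeps the
    barrier below s1, up to which f >= rho' s^beta, and below the initial plateau
    kappa0; on x >= x0 the tail takes over because Phi >= A x^q at time 0.
    The point y ranges over a neighbourhood of x at no cost, xi being
    1-Lipschitz. *)
Lemma lower_barrier f u0 u (p q A rho rho' s1 x0 kappa0 : R) :
  is_solution f u0 u -> 0 < p -> 0 < q < 1 -> 0 < A -> 0 < rho < rho' ->
  0 < s1 <= 1 ->
  (forall s, 0 <= s <= s1 -> rho' * rpow s (1 + p) <= f s) ->
  0 < x0 -> 0 < kappa0 ->
  (forall x, x <= x0 -> kappa0 <= u0 x) ->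
  (forall x, x0 <= x -> Rpower (A * Rpower x q) (- / p) <= u0 x) ->
  exists kappa B, 0 < kappa /\
    forall t x y, 0 <= t -> 0 < x ->
      A * (Rpower x q + Rabs (y - x)) + B <= rho * p * t -> kappa <= u t y.
Proof.
  intros hu hp hq hA hrho hs1 hf hx0 hkappa0 hleft hright.
  set (k := / p) in *.
  assert (hk : 0 < k) by (apply Rinv_0_lt_compat, hp).
  assert (hkp : k * p = 1) by (unfold k; field; lra).
  set (D := k * A ^ 2 + k * A).
  assert (hA2 : 0 < A ^ 2) by (apply pow_lt, hA).
  assert (hD : 0 < D) by (unfold D; nra).
  set (mu := Rmin 1 ((rho' - rho) / D)).
  assert (hmu : 0 < mu).
  { apply Rmin_glb_lt; [lra|]. apply Rdiv_lt_0_compat; lra. }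
  assert (hmu1 : mu <= 1) by apply Rmin_l.
  assert (hmuD : D * mu <= rho' - rho).
  { apply Rle_trans with (D * ((rho' - rho) / D)).
    - apply Rmult_le_compat_l; [lra|apply Rmin_r].
    - right; field; lra. }
  destruct (regularized_power_exists q mu hq hmu) as [xi [dxi [ddxi [B hxi]]]].
  assert (hlip := regularized_power_lipschitz _ _ _ _ _ _ hxi).
  set (m := Rmin s1 kappa0).
  assert (hm : 0 < m) by (apply Rmin_glb_lt; lra).
  set (K := Rpower m (- / k)).
  assert (hK : 0 < K) by apply exp_pos.
  assert (hKm : Rpower K (- k) = m) by (apply Rpower_neg_root; lra).
  set (phi := fun t x => A * xi x - rho * p * t).
  set (Phi := fun t x => K + soft_pos (phi t x)).
  set (v := fun t x => Rpower (Phi t x) (- k)).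
  assert (hv0 : forall t x, 0 < v t x) by (intros; apply exp_pos).
  assert (hPhiK : forall t x, K < Phi t x).
  { intros t x. destruct (soft_pos_bounds (phi t x)). unfold Phi; lra. }
  assert (hvm : forall t x, v t x <= m).
  { intros t x. rewrite <- hKm. apply Rpower_neg_antitone; [lra|].
    specialize (hPhiK t x). lra. }
  assert (hms : m <= s1) by apply Rmin_l. assert (hmk : m <= kappa0) by apply Rmin_r.
  assert (hphix : forall t y, is_derive (phi t) y (A * dxi y)).
  { intros t y. unfold phi. assert (hd := rp_derive _ _ _ _ _ _ hxi y).
    auto_derive; [eexists; exact hd|].
    rewrite (is_derive_unique (fun y : R => xi y) y _ hd). ring. }
  assert (hphit : forall s y, is_derive (fun s => phi s y) s (- (rho * p))).
  { intros s y. unfold phi. auto_derive; [exact I|ring]. }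
  assert (hPx : forall t y, is_derive (Phi t) y (A * dxi y * soft_pos' (phi t y))).
  { intros t y. unfold Phi. rewrite <- (Rplus_0_l (_ * soft_pos' _)).
    apply (is_derive_plus (V := R_NormedModule) (fun _ => K));
      [exact (is_derive_const (V := R_NormedModule) K _)|].
    apply (is_derive_comp (V := R_NormedModule) soft_pos (phi t));
      [apply is_derive_soft_pos|apply hphix]. }
  assert (hPt : forall s y, is_derive (fun s => Phi s y) s
                  (- (rho * p) * soft_pos' (phi s y))).
  { intros s y. unfold Phi. rewrite <- (Rplus_0_l (_ * soft_pos' _)).
    apply (is_derive_plus (V := R_NormedModule) (fun _ => K));
      [exact (is_derive_const (V := R_NormedModule) K _)|].
    apply (is_derive_comp (V := R_NormedModule) soft_pos (fun s => phi s y));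
      [apply is_derive_soft_pos|apply hphit]. }
  assert (hcmp : forall t x, 0 <= t -> v t x <= u t x).
  { intros t1 x1 ht1. apply Rminus_le.
    apply (maximum_principle (fun t x => v t x - u t x) (rho' * (1 + p)) t1 1).
    - nra.
    - apply (continuous_from_0_minus v u); [|exact (continuous_from_0_solution _ _ _ hu)].
      apply continuous_from_0_of_continuous. intros t x.
      apply (continuous_comp (fun s : R * R => phi (fst s) (snd s))
               (fun y => Rpower (K + soft_pos y) (- k))).
      + apply (continuous_minus (V := R_NormedModule)
          (fun s : R * R => A * xi (snd s)) (fun s => rho * p * fst s)).
        * apply (continuous_space (fun y => A * xi y)). intros y.
          apply (ex_derive_scal xi A), (ex_derive_regularized_power _ _ _ _ _ _ _ hxi).
        * apply (continuous_time (fun s => rho * p * s)). intros; auto_derive; exact I.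
      + apply (continuous_comp (fun y => K + soft_pos y) (fun y => Rpower y (- k))).
        * apply (continuous_plus (V := R_NormedModule) (fun _ => K));
            [apply continuous_const|].
          apply (ex_derive_continuous (V := R_NormedModule)).
          eexists; apply is_derive_soft_pos.
        * apply (ex_derive_continuous (V := R_NormedModule)). eexists.
          apply is_derive_Rpower. exact (Rlt_trans _ _ _ hK (hPhiK t x)).
    - intros t x ht. assert (hr := sol_range _ _ _ hu t x (proj1 ht)).
      unfold unit_interval in hr. specialize (hvm t x). lra.
    - intros x. rewrite (sol_init _ _ _ hu). apply Rle_minus.
      destruct (Rle_dec x x0) as [hx|hx].
      + specialize (hleft x hx). specialize (hvm 0 x). lra.
      + apply Rle_trans with (2 := hright x ltac:(lra)).
        apply Rpower_neg_antitone; [lra|]. split.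
        * apply Rmult_lt_0_compat; [lra|apply exp_pos].
        * assert (hlo := rp_lower _ _ _ _ _ _ hxi x ltac:(lra)).
          destruct (soft_pos_bounds (phi 0 x)) as [_ hsp].
          unfold Phi. unfold phi in hsp |- *. nra.
    - intros t x ht hz.
      assert (hr := sol_range _ _ _ hu t x ltac:(lra)). unfold unit_interval in hr.
      assert (hvle := hvm t x).
      assert (hPxx : is_derive (fun y => A * dxi y * soft_pos' (phi t y)) x
         (A * ddxi x * soft_pos' (phi t x) +
          A * dxi x * (A * dxi x * soft_pos'' (phi t x)))).
      { apply (is_derive_mult (fun y => A * dxi y) (fun y => soft_pos' (phi t y)) x
          (A * ddxi x) (A * dxi x * soft_pos'' (phi t x))).
        - apply is_derive_scal, (rp_derive2 _ _ _ _ _ _ hxi).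
        - apply (is_derive_comp (V := R_NormedModule) soft_pos' (phi t));
            [apply is_derive_soft_pos'|apply hphix].
        - exact Rmult_comm. }
      assert (hdv := has_heat_derivatives_negative_power k Phi t x _ _ _
        (Rlt_trans _ _ _ hK (hPhiK t x)) (hPt t x) (filter_forall _ (hPx t)) hPxx).
      destruct (solution_has_heat_derivatives f u0 u t x hu ltac:(lra)) as [ut [uxx [hdu he]]].
      eexists; eexists; split; [exact (has_heat_derivatives_minus v u _ _ _ _ _ _ hdv hdu)|].
      assert (hV : Rpower (Phi t x) (- k - 1) = rpow (v t x) (1 + p)).
      { rewrite rpow_pos_eq by apply hv0. unfold v. rewrite Rpower_mult. f_equal. lra. }
      rewrite hV.
      assert (hVp : 0 < rpow (v t x) (1 + p)) by (rewrite <- hV; apply exp_pos).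
      set (V := rpow (v t x) (1 + p)) in *.
      assert (hLip : V - rpow (u t x) (1 + p) <= (1 + p) * (v t x - u t x)).
      { apply rpow_lipschitz; lra. }
      assert (hfu := hf (u t x) ltac:(lra)).
      assert (hs := rp_slope _ _ _ _ _ _ hxi x). assert (hb := rp_bend _ _ _ _ _ _ hxi x).
      assert (hb' : ddxi x <= mu) by (apply Rle_trans with (2 := hb), Rle_abs).
      assert (h1 : (dxi x) ^ 2 <= mu).
      { rewrite <- pow2_abs. assert (0 <= Rabs (dxi x)) by apply Rabs_pos. nra. }
      assert (h0 : 0 <= (dxi x) ^ 2) by apply pow2_ge_0.
      assert (hq1 := soft_pos'_bounds (phi t x)).
      assert (hq2 := soft_pos''_bounds (phi t x)).
      set (g1 := soft_pos' (phi t x)) in *. set (g2 := soft_pos'' (phi t x)) in *.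
      assert (hconv : 0 <= k * (k + 1) * (A * dxi x * g1) ^ 2 / Phi t x).
      { assert (0 < / Phi t x) by
          (apply Rinv_0_lt_compat; exact (Rlt_trans _ _ _ hK (hPhiK t x))).
        apply Rmult_le_pos; [|lra]. apply Rmult_le_pos; [nra|apply pow2_ge_0]. }
      assert (hbend : k * (A * ddxi x * g1 + A * dxi x * (A * dxi x * g2)) <= rho' - rho).
      { apply Rle_trans with (D * mu); [|exact hmuD].
        assert (ddxi x * g1 <= mu) by nra.
        assert ((dxi x) ^ 2 * g2 <= mu) by nra.
        assert (0 < k * A) by nra. assert (0 < k * A ^ 2) by nra.
        replace (k * (A * ddxi x * g1 + A * dxi x * (A * dxi x * g2)))
          with (k * A * (ddxi x * g1) + k * A ^ 2 * ((dxi x) ^ 2 * g2)) by ring.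
        unfold D. nra. }
      assert (hfin : - k * (- (rho * p) * g1) <= rho).
      { replace (- k * (- (rho * p) * g1)) with (k * p * (rho * g1)) by ring.
        rewrite hkp. nra. }
      set (T1 := - k * (- (rho * p) * g1)) in *.
      set (T2 := k * (k + 1) * (A * dxi x * g1) ^ 2 / Phi t x) in *.
      set (T3 := k * (A * ddxi x * g1 + A * dxi x * (A * dxi x * g2))) in *.
      assert (hmain : V * (T1 - T2 + T3) <= V * rho') by (apply Rmult_le_compat_l; lra).
      assert (hmain2 : rho' * (V - rpow (u t x) (1 + p)) <=
                       rho' * ((1 + p) * (v t x - u t x)))
        by (apply Rmult_le_compat_l; lra).
      lra.
    - lra. }
  (* Behind the front the argument of soft_pos is nonpositive, so Phi <= K + 1/2. *)
  exists (Rpower (K + 1 / 2) (- k)), (A * B). split; [apply exp_pos|].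
  intros t x y ht hx h.
  apply Rle_trans with (2 := hcmp t y ht).
  apply Rpower_neg_antitone; [lra|]. split; [specialize (hPhiK t y); lra|].
  apply Rplus_le_compat_l, soft_pos_nonpos. unfold phi.
  assert (hup := rp_upper _ _ _ _ _ _ hxi x hx). specialize (hlip x y).
  assert (0 <= Rabs (y - x)) by apply Rabs_pos.
  assert (xi y <= Rpower x q + B + Rabs (y - x)) by nra.
  assert (A * xi y <= A * (Rpower x q + B + Rabs (y - x))) by (apply Rmult_le_compat_l; lra).
  lra.
Qed.

(** * From a small plateau to any level below 1 *)

Lemma continuity_pt_of_C1 f df s :
  C1_unit_interval f df -> 0 < s < 1 -> continuity_pt f s.
Proof.
  intros h hs. destruct (h s) as [hd _]; [unfold unit_interval; lra|].
  apply derivable_continuous_pt. exists (df s).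
  intros e he. destruct (hd e he) as [a [ha hlim]].
  assert (hm : 0 < Rmin a (Rmin s (1 - s))) by (repeat apply Rmin_glb_lt; lra).
  exists (mkposreal _ hm). intros h0 hn hb. simpl in hb.
  assert (h1 := Rmin_l a (Rmin s (1 - s))). assert (h2 := Rmin_r a (Rmin s (1 - s))).
  assert (h3 := Rmin_l s (1 - s)). assert (h4 := Rmin_r s (1 - s)).
  assert (hb' := Rabs_def2 _ _ hb).
  specialize (hlim (s + h0)). simpl in hlim. unfold R_dist in hlim.
  replace (s + h0 - s) with h0 in hlim by ring. apply hlim.
  split; [split; [unfold unit_interval; lra|lra]|lra].
Qed.

(** Let m > 0 be the minimum of f on [kappa, l].  The parabola
    kappa + (m/2) s - (m/8) (y - x1)^2 is a subsolution as long as u stays in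
    [kappa, l], since m/2 + m/4 < m.  Its vertex climbs from kappa to l in time
    tau, while on the edge of a wide enough window it remains nonpositive. *)
Lemma growth_from_plateau f df u0 u (kappa l : R) :
  C1_unit_interval f df -> (forall s, 0 < s < 1 -> 0 < f s) ->
  is_solution f u0 u -> 0 < kappa < l -> l < 1 ->
  exists tau M, 0 < tau /\ 0 < M /\
    forall t0 x1, 0 < t0 ->
      (forall s y, 0 <= s <= tau -> Rabs (y - x1) <= M -> kappa <= u (t0 + s) y) ->
      l <= u (t0 + tau) x1.
Proof.
  intros hC1 hf hu hk hl.
  destruct (continuity_ab_min f kappa l) as [c [hmin hc]].
  { lra. }
  { intros s hs. apply continuity_pt_of_C1 with df; [exact hC1|lra]. }
  assert (hm : 0 < f c) by (apply hf; lra).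
  set (m := f c) in *.
  assert (him : 0 < / m) by (apply Rinv_0_lt_compat, hm).
  (* The vertex reaches l at time tau, and M is large enough that
     (m/8) M^2 >= 1 >= l. *)
  exists (2 * (l - kappa) / m), (1 + 8 / m).
  assert (htau : 0 < 2 * (l - kappa) / m) by (apply Rdiv_lt_0_compat; lra).
  assert (hM : m / 8 * (1 + 8 / m) = m / 8 + 1) by (field; lra).
  set (tau := 2 * (l - kappa) / m) in *. set (M := 1 + 8 / m) in *.
  assert (hM1 : 1 <= M) by (unfold M, Rdiv; lra).
  split; [exact htau|]. split; [lra|].
  intros t0 x1 ht0 hwin.
  assert (htm : m / 2 * tau = l - kappa) by (unfold tau; field; lra).
  set (v := fun s y => kappa + m / 2 * s - m / 8 * (y - x1) ^ 2).
  assert (hcmp : v tau x1 - u (t0 + tau) x1 <= 0).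
  { apply (maximum_principle (fun s y => v s y - u (t0 + s) y) 0 tau 1).
    - lra.
    - apply (continuous_from_0_minus v (fun s y => u (t0 + s) y)).
      + apply continuous_from_0_of_continuous. intros t x. unfold v.
        apply (continuous_minus (fun p : R * R => kappa + m / 2 * fst p)
                 (fun p : R * R => m / 8 * (snd p - x1) ^ 2)).
        * apply (continuous_time (fun s => kappa + m / 2 * s)). intros; auto_derive; exact I.
        * apply (continuous_space (fun y => m / 8 * (y - x1) ^ 2)).
          intros; auto_derive; exact I.
      + apply continuous_from_0_shift; [lra|]. exact (continuous_from_0_solution _ _ _ hu).
    - intros s y hs. assert (hr := sol_range _ _ _ hu (t0 + s) y ltac:(lra)).
      unfold unit_interval in hr. assert (h2 : 0 <= (y - x1) ^ 2) by apply pow2_ge_0.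
      unfold v. nra.
    - intros y. unfold v. rewrite Rmult_0_r.
      assert (h2 : 0 <= (y - x1) ^ 2) by apply pow2_ge_0.
      destruct (Rle_dec (Rabs (y - x1)) M) as [hy|hy].
      + specialize (hwin 0 y ltac:(lra) hy). nra.
      + assert (hr := sol_range _ _ _ hu (t0 + 0) y ltac:(lra)). unfold unit_interval in hr.
        assert (M * M <= (y - x1) ^ 2) by (rewrite <- pow2_abs; nra). nra.
    - intros s y hs hz.
      assert (hr := sol_range _ _ _ hu (t0 + s) y ltac:(lra)). unfold unit_interval in hr.
      assert (h2 : 0 <= (y - x1) ^ 2) by apply pow2_ge_0.
      assert (hy : Rabs (y - x1) <= M).
      { apply Rnot_lt_le; intros hy. unfold v in hz.
        assert (M * M <= (y - x1) ^ 2) by (rewrite <- pow2_abs; nra). nra. }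
      assert (hlow := hwin s y ltac:(lra) hy).
      assert (hfu : m <= f (u (t0 + s) y)).
      { apply hmin. unfold v in hz. nra. }
      destruct (solution_has_heat_derivatives f u0 u (t0 + s) y hu ltac:(lra))
        as [ut [uxx [hd he]]].
      exists (m / 2 - ut), (- (m / 4) - uxx). split; [|lra].
      apply (has_heat_derivatives_minus v (fun s y => u (t0 + s) y));
        [|apply has_heat_derivatives_shift, hd].
      split; [unfold v; auto_derive; [exact I|ring]|].
      exists (fun y => - (m / 4) * (y - x1)). split.
      + apply filter_forall; intros y'. unfold v; auto_derive; [exact I|field].
      + auto_derive; [exact I|ring].
    - lra. }
  unfold v in hcmp. replace ((x1 - x1) ^ 2) with 0 in hcmp by ring. lra.
Qed.

(** * The hypotheses on f and u0, and the fronts *)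

(** The tail c x^(-alpha) is the time-zero value of the ODE profile. *)
Lemma algebraic_tail_eq (alpha p c x : R) :
  0 < p -> 0 < c ->
  c / Rpower x alpha = Rpower (Rpower c (- p) * Rpower x (alpha * p)) (- / p).
Proof.
  intros hp hc. rewrite <- Rpower_mult_distr by apply exp_pos.
  rewrite !Rpower_mult.
  replace (- p * - / p) with 1 by (field; lra).
  replace (alpha * p * - / p) with (- alpha) by (field; lra).
  rewrite Rpower_1, Rpower_Ropp by exact hc. reflexivity.
Qed.

Lemma front_power (alpha beta k c t : R) :
  0 < alpha -> 1 < beta -> 0 < k -> 0 < t ->
  Rpower c (- (beta - 1)) * Rpower (front alpha beta k c t) (alpha * (beta - 1))
  = k * (beta - 1) * t.
Proof.
  intros ha hb hk ht. unfold front. rewrite Rpower_mult.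
  assert (0 < alpha * (beta - 1)) by nra.
  replace (1 / (alpha * (beta - 1)) * (alpha * (beta - 1))) with 1 by (field; nra).
  assert (hc : 0 < Rpower c (beta - 1)) by apply exp_pos.
  rewrite Rpower_1.
  - rewrite Rpower_Ropp. field. lra.
  - repeat apply Rmult_lt_0_compat; lra.
Qed.

(** Near -oo the lower limit gives a positive bound; the rest is a compact
    interval on which [u0] is continuous and positive. *)
Lemma positive_on_left_half_line (u0 : R -> R) (b : R) :
  uniform_continuity u0 (fun _ => True) -> (forall x, 0 < u0 x) ->
  Rbar_lt 0 (LimInf_minfty u0) ->
  exists kappa, 0 < kappa /\ forall x, x <= b -> kappa <= u0 x.
Proof.
  intros huc hpos hlim.
  assert (ha : exists a l, 0 < l /\ forall x, x <= a -> l <= u0 x).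
  { apply NNPP; intros hn.
    apply (Rbar_lt_not_le _ _ hlim).
    unfold LimInf_minfty, Rbar_lub. destruct Rbar_ex_lub as [m [hub hleast]]. simpl.
    apply hleast. intros v [a ->].
    destruct (Rbar_le_lt_dec (inf_left u0 a) 0) as [h|h]; [exact h|exfalso].
    assert (hg := Glb_Rbar_correct (fun y => exists x, x <= a /\ y = u0 x)).
    fold (inf_left u0 a) in hg. destruct hg as [hlb _].
    assert (hval : forall x, x <= a -> Rbar_le (inf_left u0 a) (u0 x)).
    { intros x hx. apply hlb. exists x; split; [exact hx|reflexivity]. }
    destruct (inf_left u0 a) as [l| |].
    - apply hn. exists a, l. split; [exact h|]. intros x hx; exact (hval x hx).
    - exact (hval a (Rle_refl a)).
    - exact h. }
  destruct ha as [a [l [hl ha]]].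
  destruct (Rle_dec b a) as [hba|hba].
  { exists l; split; [exact hl|]. intros x hx; apply ha; lra. }
  destruct (continuity_ab_min u0 a b) as [c [hc _]]; [lra| |].
  { intros x _ e he. destruct (huc (mkposreal e he)) as [d hd].
    exists d; split; [apply cond_pos|]. intros y [_ hy]. apply hd; auto. }
  exists (Rmin l (u0 c)). split; [apply Rmin_glb_lt; [exact hl|apply hpos]|].
  intros x hx. destruct (Rle_dec x a) as [hxa|hxa].
  - apply Rle_trans with (1 := Rmin_l _ _). apply ha, hxa.
  - apply Rle_trans with (1 := Rmin_r _ _). apply hc; lra.
Qed.

(** For small s the factor 1 - s^delta exceeds r'/r, so the correction costs an
    arbitrarily small part of the rate. *)
Lemma pure_power_lower_bound (f : R -> R) (beta delta r r' s0 : R) :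
  0 < delta -> 0 < r' < r -> 0 < s0 < 1 ->
  (forall s, 0 <= s <= s0 -> f s >= r * rpow s beta * (1 - rpow s delta)) ->
  exists s1, 0 < s1 <= 1 /\ forall s, 0 <= s <= s1 -> r' * rpow s beta <= f s.
Proof.
  intros hd hr hs0 hf.
  assert (hc : 0 < 1 - r' / r).
  { assert (r' / r < 1); [|lra]. apply (Rmult_lt_reg_r r); [lra|].
    unfold Rdiv; rewrite Rmult_assoc, Rinv_l; lra. }
  exists (Rmin s0 (Rpower (1 - r' / r) (/ delta))).
  assert (h1 := Rmin_l s0 (Rpower (1 - r' / r) (/ delta))).
  assert (h2 := Rmin_r s0 (Rpower (1 - r' / r) (/ delta))).
  split; [split; [apply Rmin_glb_lt; [lra|apply exp_pos]|lra]|].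
  intros s hs. specialize (hf s ltac:(lra)).
  destruct (Req_dec s 0) as [->|hn].
  - unfold rpow in *. destruct (Rle_dec 0 0); lra.
  - rewrite !rpow_pos_eq in * by lra.
    assert (hsd : Rpower s delta <= 1 - r' / r).
    { apply Rle_trans with (Rpower (Rpower (1 - r' / r) (/ delta)) delta).
      - apply Rle_Rpower_l; lra.
      - rewrite Rpower_mult, Rinv_l, Rpower_1 by lra. lra. }
    assert (hb : 0 < Rpower s beta) by apply exp_pos.
    assert (hrr : r * (r' / r) = r') by (field; lra).
    assert (r * Rpower s beta * (r' / r) <= r * Rpower s beta * (1 - Rpower s delta)).
    { apply Rmult_le_compat_l; nra. }
    nra.
Qed.

(** * Location of the level sets *)

Theorem theorem2p6 :
  forall (f df : R -> R),
  C1_unit_interval f df ->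
  f 0 = 0 -> f 1 = 0 ->
  (forall s, 0 < s < 1 -> 0 < f s) ->
  df 0 = 0 ->
  forall (u0 : R -> R),
  (forall x, unit_interval (u0 x)) ->
  uniform_continuity u0 (fun _ => True) ->
  (forall x, 0 < u0 x) ->
  Rbar_lt 0 (LimInf_minfty u0) ->
  is_lim u0 p_infty 0 ->
  forall (u : R -> R -> R),
  is_solution f u0 u ->
  forall (gamma : R),
  0 < gamma ->
  spreads_at_speed u gamma ->
  forall (alpha delta beta : R),
  0 < alpha -> 0 < delta -> 1 < beta ->
  beta < 1 + 1 / alpha ->
  forall (C Cbar x0 : R),
  0 < C -> 0 < Cbar -> 1 < x0 ->
  (forall x, x0 <= x ->
     Cbar / Rpower x alpha >= u0 x /\ u0 x >= C / Rpower x alpha) ->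
  forall (r s0 : R),
  0 < r -> 0 < s0 < 1 ->
  (forall s, 0 <= s <= s0 -> f s >= r * rpow s beta * (1 - rpow s delta)) ->
  forall (rbar : R),
  0 < rbar ->
  (forall s, 0 <= s <= 1 -> rbar * rpow s beta >= f s) ->
  forall (lambda t_lambda : R),
  0 < lambda < 1 ->
  is_level_time u gamma lambda t_lambda ->
  forall (eps : R),
  0 < eps < r ->
  exists T : R,
    t_lambda <= T /\
    forall t, T <= t ->
      forall x, level_set u lambda t x ->
        front alpha beta (r - eps) C t < x < front alpha beta (rbar + eps) Cbar t.
Proof.
  intros f df hC1 _ _ hf _ u0 _ huc hu0pos hliminf _ u hu gamma hgamma _
    alpha delta beta halpha hdelta hbeta hbeta' C Cbar x0 hC hCbar hx0 htail
    r s0 hr hs0 hflow rbar hrbar hfup lambda t_lambda hlambda [htl hlev] eps heps.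
  set (p := beta - 1). set (q := alpha * p).
  assert (hp : 0 < p) by (unfold p; lra).
  assert (hbp : beta = 1 + p) by (unfold p; ring).
  assert (hq : 0 < q < 1).
  { unfold q. split; [nra|]. replace 1 with (alpha * (1 / alpha)) by (field; lra).
    apply Rmult_lt_compat_l; unfold p; lra. }
  assert (hep : 0 < eps / 2 * p) by (apply Rmult_lt_0_compat; lra).
  set (Abar := Rpower Cbar (- p)).
  assert (hAbar : 0 < Abar) by apply exp_pos.
  destruct (upper_barrier f u0 u p q Abar rbar (rbar + eps / 2) x0) as [Bbar hupper];
    try assumption; try lra.
  { intros s hs. rewrite <- hbp. apply Rge_le, hfup, hs. }
  { intros x hx. unfold Abar, q. rewrite <- algebraic_tail_eq by assumption.
    apply Rge_le, htail, hx. }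
  set (Llam := Rpower lambda (- p)).
  assert (hL : 0 < Llam) by apply exp_pos.
  assert (hL1 : 1 <= Llam).
  { unfold Llam. apply Rle_trans with (Rpower 1 (- p)).
    - right. unfold Rpower. rewrite ln_1, Rmult_0_r, exp_0. reflexivity.
    - apply Rpower_neg_antitone; lra. }
  set (A := Rpower C (- p)).
  assert (hA : 0 < A) by apply exp_pos.
  destruct (pure_power_lower_bound f beta delta r (r - eps / 4) s0) as [s1 [hs1 hfs1]];
    try assumption; try lra.
  destruct (positive_on_left_half_line u0 x0 huc hu0pos hliminf) as [kappa0 [hkappa0 hleft]].
  destruct (lower_barrier f u0 u p q A (r - eps / 2) (r - eps / 4) s1 x0 kappa0)
    as [kappa [B [hkappa hlower]]]; try assumption; try lra.
  { rewrite <- hbp. exact hfs1. }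
  { intros x hx. unfold A, q. rewrite <- algebraic_tail_eq by assumption.
    apply Rge_le, htail, hx. }
  assert (hmin1 := Rmin_l kappa (lambda / 2)). assert (hmin2 := Rmin_r kappa (lambda / 2)).
  destruct (growth_from_plateau f df u0 u (Rmin kappa (lambda / 2)) ((1 + lambda) / 2))
    as [tau [M [htau [hM hgrow]]]]; try assumption; try lra.
  { split; [apply Rmin_glb_lt|]; lra. }
  (* T1 and T2 are the times after which the gain (eps/2) p t of the fronts over
     the barriers exceeds the bounded errors: the additive constants, the width M
     of the window and the delay tau of the plateau growth. *)
  set (T1 := (Bbar + Llam + 1) / (eps / 2 * p)).
  set (T2 := (A * M + B + (r - eps / 2) * p * tau) / (eps / 2 * p)).
  exists (Rmax (Rmax t_lambda (tau + 1)) (Rmax T1 T2)).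
  split.
  { apply Rle_trans with (2 := Rmax_l _ _), Rmax_l. }
  intros t ht x hx.
  assert (htt : t_lambda <= t).
  { apply Rle_trans with (2 := ht), Rle_trans with (2 := Rmax_l _ _), Rmax_l. }
  assert (httau : tau + 1 <= t).
  { apply Rle_trans with (2 := ht), Rle_trans with (2 := Rmax_l _ _), Rmax_r. }
  assert (ht1 : T1 <= t).
  { apply Rle_trans with (2 := ht), Rle_trans with (2 := Rmax_r _ _), Rmax_l. }
  assert (ht2 : T2 <= t).
  { apply Rle_trans with (2 := ht), Rle_trans with (2 := Rmax_r _ _), Rmax_r. }
  assert (htpos : 0 < t) by lra.
  assert (hxpos : 0 < x).
  { assert (h := proj2 (hlev t htt) x hx). assert (0 < gamma * t) by nra. lra. }
  assert (hT1 : Bbar + Llam + 1 <= eps / 2 * p * t).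
  { replace (Bbar + Llam + 1) with (eps / 2 * p * T1) by (unfold T1; field; lra).
    apply Rmult_le_compat_l; lra. }
  assert (hT2 : A * M + B + (r - eps / 2) * p * tau <= eps / 2 * p * t).
  { replace (A * M + B + (r - eps / 2) * p * tau) with (eps / 2 * p * T2)
      by (unfold T2; field; lra).
    apply Rmult_le_compat_l; lra. }
  unfold level_set in hx.
  split; apply Rnot_le_lt; intros hfront.
  - assert (hxq : A * Rpower x q <= (r - eps) * p * t).
    { unfold A, q, p. rewrite <- (front_power alpha beta (r - eps) C t) by lra.
      apply Rmult_le_compat_l; [left; apply exp_pos|]. apply Rle_Rpower_l; [nra|lra]. }
    assert (hbig : (1 + lambda) / 2 <= u (t - tau + tau) x).
    { apply hgrow; [lra|]. intros s y hs hy.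
      apply Rle_trans with (1 := hmin1). apply (hlower _ x); [lra|exact hxpos|].
      assert (A * Rabs (y - x) <= A * M) by (apply Rmult_le_compat_l; lra).
      assert (0 <= (r - eps / 2) * p * s).
      { apply Rmult_le_pos; [apply Rmult_le_pos|]; lra. }
      lra. }
    replace (t - tau + tau) with t in hbig by ring. lra.
  - assert (hxq : (rbar + eps) * p * t <= Abar * Rpower x q).
    { unfold Abar, q, p. rewrite <- (front_power alpha beta (rbar + eps) Cbar t) by lra.
      apply Rmult_le_compat_l; [left; apply exp_pos|].
      apply Rle_Rpower_l; [nra|split; [apply exp_pos|exact hfront]]. }
    set (Y := Abar * Rpower x q - (rbar + eps / 2) * p * t - Bbar).
    assert (hY : Llam < Y) by (unfold Y; lra).
    assert (hsmall : u t x <= Rpower Y (- / p)).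
    { apply hupper; [lra|exact hxpos|]. fold Y. lra. }
    assert (hlt : Rpower Y (- / p) < Rpower Llam (- / p)).
    { apply Rpower_neg_antitone_strict; [apply Rinv_0_lt_compat, hp|lra]. }
    assert (heq : Rpower Llam (- / p) = lambda).
    { unfold Llam. rewrite Rpower_mult.
      replace (- p * - / p) with 1 by (field; lra). apply Rpower_1; lra. }
    lra.
Qed.
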